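(* Let $A:\mathbb{R}^n\to\mathbb{R}^n$ be a linear operator that is generalized strictly sign-regular (GSSR) with respect to a totally positive structure $\{K_1,\ldots,K_n\}$. Then for every $j=1,\ldots,n$ the interior of $T(K_j)$ is nonempty and $$A\big(T(K_j)\setminus\{0\}\big)\subseteq\operatorname{int}(T(K_j)).$$
   Context: A proper cone in a finite-dimensional real space is a closed convex cone that is pointed ($K\cap(-K)=\{0\}$) and solid ($\operatorname{int}K\ne\emptyset$). $\wedge^j\mathbb{R}^n$ is the $j$th exterior power of $\mathbb{R}^n$, and for a linear operator $A$ on $\mathbb{R}^n$, $\wedge^jA$ is the operator on $\wedge^j\mathbb{R}^n$ with $(\wedge^jA)(x_1\wedge\cdots\wedge x_j)=Ax_1\wedge\cdots\wedge Ax_j$ ($\wedge^1A=A$). A linear operator $B$ is $K$-positive if $B(K\setminus\{0\})\subseteq\operatorname{int}(K)$. A totally positive structure on $\mathbb{R}^n$ is a family $\{K_1,\ldots,K_n\}$ with $K_j\subset\wedge^j\mathbb{R}^n$ a proper cone. $A$ is GSSR with respect to it if there are $\epsilon_1,\ldots,\epsilon_n\in\{1,-1\}$ such that $\epsilon_j\wedge^jA$ is $K_j$-positive for every $j=1,\ldots,n$. Define $T(K_1)=K_1\cup(-K_1)$, and for $j\ge2$ let $T(K_j)$ be the closure of the set of all $x_1\in\mathbb{R}^n$ for which there exist $x_2,\ldots,x_j\in\mathbb{R}^n$ with $x_1\wedge x_2\wedge\cdots\wedge x_j\in\operatorname{int}(K_j)\cup\operatorname{int}(-K_j)$. *)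

(* Defs.v *)
From HB Require Import structures.
From mathcomp Require Import all_boot all_order all_algebra.
From mathcomp Require Import all_classical all_reals all_analysis.
Set Implicit Arguments. Unset Strict Implicit. Unset Printing Implicit Defensive.
Import Order.TTheory GRing.Theory Num.Theory.
Import numFieldNormedType.Exports.
Local Open Scope classical_set_scope.
Local Open Scope ring_scope.

(* Concrete model of the exterior power: wedge^j R^n is identified with
   R^{C(n,j)} via Pluecker coordinates, coordinates indexed by the
   j-element subsets of 'I_n. *)
Definition ksub (n j : nat) := {S : {set 'I_n} | #|S| == j}.
Definition wdim (n j : nat) := #|{: ksub n j}|.

(* the increasingly ordered enumeration of a j-subset: 'I_j -> 'I_n *)
Definition ksub_fun n j (s : ksub n j) (i : 'I_j) : 'I_n :=
  @enum_val _ (mem (val s)) (cast_ord (esym (eqP (valP s))) i).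

(* x_1 /\ ... /\ x_j, where the x_k are the columns of X *)
Definition wedge (R : realType) n j (X : 'M[R]_(n, j)) : 'cV[R]_(wdim n j) :=
  \col_(k < wdim n j) \det (rowsub (ksub_fun (enum_val k)) X).

Definition compound (R : realType) n j (A : 'M[R]_n) : 'M[R]_(wdim n j) :=
  \matrix_(k < wdim n j, l < wdim n j)
     \det (mxsub (ksub_fun (enum_val k)) (ksub_fun (enum_val l)) A).

Definition closed_convex_cone (R : realType) m (K : set 'cV[R]_m) :=
  [/\ closed K, K 0,
      (forall x y, K x -> K y -> K (x + y)) &
      (forall (a : R) x, 0 <= a -> K x -> K (a *: x))].

Definition proper_cone (R : realType) m (K : set 'cV[R]_m) :=
  [/\ closed_convex_cone K,
      K `&` [set - x | x in K] = [set 0] &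
      interior K !=set0].

Definition K_positive (R : realType) m (B : 'M[R]_m) (K : set 'cV[R]_m) :=
  forall x, K x -> x != 0 -> interior K (B *m x).

Definition TP_structure (R : realType) n
  (K : forall j : nat, set 'cV[R]_(wdim n j)) :=
  forall j, (1 <= j <= n)%N -> proper_cone (K j).

Definition GSSR (R : realType) n (A : 'M[R]_n)
  (K : forall j : nat, set 'cV[R]_(wdim n j)) :=
  exists eps : nat -> R, forall j, (1 <= j <= n)%N ->
    (eps j = 1 \/ eps j = -1) /\ K_positive (eps j *: compound j A) (K j).

Definition neg_set (R : realType) m (K : set 'cV[R]_m) := [set - x | x in K].

(* T(K_j) as a subset of R^n (only meaningful for 1 <= j; T(K_0) is unused) *)
Definition TK (R : realType) n j (K : set 'cV[R]_(wdim n j)) : set 'cV[R]_n :=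
  match j return set 'cV[R]_(wdim n j) -> set 'cV[R]_n with
  | 0 => fun _ => set0
  | 1 => fun K => [set x | (K `|` neg_set K) (wedge x)]
  | j'.+2 => fun K => closure [set x | exists X : 'M[R]_(n, j'.+2),
            col 0 X = x /\ (interior K `|` interior (neg_set K)) (wedge X)]
  end K.

(* Main.v *)
(** Write [U] for [int K_j `|` int (-K_j)].  The set of first columns of matrices
    [X] with [wedge X] in [U] is open.  Every nonzero [x] in its closure is the first
    column of some [Z] with [wedge Z] a nonzero element of [K_j `|` -K_j]:
    multiplying a full-rank [X] on the right by the inverse of a [j x j] submatrix
    of maximal determinant gives a matrix with entries in [[-1, 1]] and an identity
    submatrix, and such matrices form a compact set.  By Cauchy-Binet and positivity
    of the compound matrix, [wedge (A *m Z)] lies in [U], so [A *m x] is interior.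

    That [U] contains a decomposable vector needs no Perron eigenvector.  Let
    [B] be [K]-positive and [u] interior to [K].  If neither [B v] nor [- B v] is
    interior, then [-t u <= v <= t u] implies [-q t B u <= B v <= q t B u] with a
    uniform [q < 1].  If no iterate of a standard basis vector (which is decomposable)
    entered [U], all of them would be negligible against [B^N u], although
    [B^N u] is a fixed linear combination of them. *)

Require Import Defs.
From HB Require Import structures.
From mathcomp Require Import all_boot all_order all_algebra.
From mathcomp Require Import perm ring lra.
From mathcomp Require Import all_classical all_reals all_analysis.
Set Implicit Arguments. Unset Strict Implicit. Unset Printing Implicit Defensive.
Import Order.TTheory GRing.Theory Num.Theory.
Import numFieldNormedType.Exports.
Local Open Scope classical_set_scope.
Local Open Scope ring_scope.

(** * Cauchy-Binet and wedge products *)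

Lemma ksub_fun_inj n j (s : ksub n j) : injective (ksub_fun s).
Proof. by move=> i k /enum_val_inj /cast_ord_inj. Qed.

Lemma ksub_fun_in n j (s : ksub n j) i : ksub_fun s i \in val s.
Proof. exact: (@enum_valP _ (mem (val s))). Qed.

Lemma ksub_fun_onto n j (s : ksub n j) x :
  x \in val s -> exists i, ksub_fun s i = x.
Proof.
move=> xs; exists (cast_ord (eqP (valP s)) (enum_rank_in xs x)).
by rewrite /ksub_fun cast_ordK enum_rankK_in.
Qed.

Lemma det_rowsub_noninj (R : comNzRingType) n j (f : 'I_j -> 'I_n)
  (X : 'M[R]_(n, j)) : ~~ injectiveb f -> \det (rowsub f X) = 0.
Proof.
move=> /injectivePn [i [k ik fik]].
by apply: (determinant_alternate ik) => l; rewrite !mxE fik.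
Qed.

(** An injective map factors uniquely as a permutation followed by the increasing enumeration of its
    image; Cauchy-Binet reindexes its sum along this factorization. *)
Definition ksub_perm_fun n j (p : ksub n j * 'S_j) :
  {ffun 'I_j -> 'I_n} := [ffun i => ksub_fun p.1 (p.2 i)].

Lemma ksub_perm_fun_codom n j (f : {ffun 'I_j -> 'I_n}) :
  (f \in imset (@ksub_perm_fun n j) (mem predT)) = injectiveb f.
Proof.
apply/imsetP/injectiveP => [[[s p] _ ->]|finj].
  by move=> i k; rewrite !ffunE => /ksub_fun_inj/perm_inj.
have cS : #|imset f (mem predT)| == j by rewrite card_imset // card_ord.
pose s : ksub n j := Sub (imset f (mem predT)) cS.
have fs i : exists k, ksub_fun s k == f i.
  have /ksub_fun_onto [k <-] : f i \in val s by apply/imsetP; exists i.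
  by exists k.
pose g i := xchoose (fs i).
have gP i : ksub_fun s (g i) = f i by apply/eqP/(xchooseP (fs i)).
have ginj : injective g.
  by move=> i k /(congr1 (ksub_fun s)); rewrite !gP; apply: finj.
by exists (s, perm ginj) => //; apply/ffunP => i; rewrite ffunE /= permE gP.
Qed.

Lemma ksub_perm_fun_inj n j : injective (@ksub_perm_fun n j).
Proof.
move=> [s p] [t q] /ffunP e.
have {}e i : ksub_fun s (p i) = ksub_fun t (q i) by have := e i; rewrite !ffunE.
have st : s = t.
  apply: val_inj; apply/eqP.
  rewrite eqEcard (eqP (valP s)) (eqP (valP t)) leqnn andbT.
  apply/fintype.subsetP => x /ksub_fun_onto [i <-].
  by rewrite -[i](permKV p) e ksub_fun_in.
by subst t; congr pair; apply/permP => i; apply: (@ksub_fun_inj _ _ s); apply: e.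
Qed.

(** Multilinearity in the rows expands the left side over all maps [f]. Repeated rows kill the
    non-injective ones; those with image [s] reassemble the minor of [M] through the signs of their
    permutations. *)
Lemma Cauchy_Binet (R : comNzRingType) n j (M : 'M[R]_(j, n)) (X : 'M[R]_(n, j)) :
  \det (M *m X) = \sum_(s : ksub n j)
     \det (colsub (ksub_fun s) M) * \det (rowsub (ksub_fun s) X).
Proof.
have -> : \det (M *m X) =
    \sum_(f : {ffun 'I_j -> 'I_n}) (\prod_i M i (f i)) * \det (rowsub f X).
  rewrite /determinant.
  under eq_bigr => p _.
    under eq_bigr => i _ do rewrite mxE.
    rewrite bigA_distr_bigA big_distrr /=; over.
  rewrite exchange_big /=; apply: eq_bigr => f _.
  rewrite big_distrr /=; apply: eq_bigr => p _.
  rewrite big_split /= mulrCA; congr (_ * (_ * _)).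
  by apply: eq_bigr => i _; rewrite mxE.
rewrite (bigID (fun f : {ffun _} => injectiveb f)) /= [X in _ + X]big1 ?addr0; last first.
  by move=> f /det_rowsub_noninj ->; rewrite mulr0.
under eq_bigl => f do rewrite -ksub_perm_fun_codom.
rewrite big_imset /=; last by move=> p q _ _; apply: ksub_perm_fun_inj.
pose G s p := (\prod_i M i (ksub_perm_fun (s, p) i)) *
  \det (rowsub (ksub_perm_fun (s, p)) X).
rewrite (eq_bigr (fun p => G p.1 p.2)); last by case.
rewrite -(pair_big xpredT xpredT G) /=.
apply: eq_bigr => s _; rewrite {2}/determinant big_distrl /=.
apply: eq_bigr => p _; rewrite /G.
have -> : rowsub (ksub_perm_fun (s, p)) X = row_perm p (rowsub (ksub_fun s) X).
  by apply/matrixP => i k; rewrite !mxE ffunE.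
rewrite row_permE det_mulmx det_perm mulrA; congr (_ * _).
by rewrite mulrC; congr (_ * _); apply: eq_bigr => i _; rewrite !mxE ffunE.
Qed.

Lemma det_rowsub_mul (R : realType) n m j (f : 'I_j -> 'I_m) (M : 'M[R]_(m, n))
    (X : 'M[R]_(n, j)) :
  \det (rowsub f (M *m X)) =
    \sum_(l < wdim n j) \det (mxsub f (ksub_fun (enum_val l)) M) * wedge X l ord0.
Proof.
rewrite -mul_rowsub_mx Cauchy_Binet (reindex (@enum_val _ (mem {: ksub n j}))) /=; last first.
  by apply: onW_bij; apply: enum_val_bij.
apply: eq_bigr => l _; rewrite mxE; congr (\det _ * _).
by apply/matrixP => i k; rewrite !mxE.
Qed.

Lemma wedge_mull (R : realType) n j (A : 'M[R]_n) (X : 'M[R]_(n, j)) :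
  wedge (A *m X) = compound j A *m wedge X.
Proof.
apply/colP => k; rewrite !mxE det_rowsub_mul.
by apply: eq_bigr => l _; rewrite !mxE.
Qed.

Lemma wedge_mulr (R : realType) n j (X : 'M[R]_(n, j)) (G : 'M[R]_j) :
  wedge (X *m G) = \det G *: wedge X.
Proof. by apply/colP => k; rewrite !mxE -mul_rowsub_mx det_mulmx mulrC. Qed.

(** Cauchy-Binet with the identity matrix writes any such determinant, even for [f] not increasing,
    as a combination of Pluecker coordinates. *)
Lemma wedge_eq0 (R : realType) n j (X : 'M[R]_(n, j)) (f : 'I_j -> 'I_n) :
  wedge X = 0 -> \det (rowsub f X) = 0.
Proof.
move=> X0; rewrite -[X]mul1mx det_rowsub_mul big1 // => l _.
by rewrite X0 mxE mulr0.
Qed.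

Lemma wedge_basis (R : realType) n j (k : 'I_(wdim n j)) :
  wedge (colsub (ksub_fun (enum_val k)) 1%:M) = delta_mx k 0 :> 'cV[R]__.
Proof.
apply/colP => l; rewrite !mxE eqxx andbT.
case: eqP => [->|/eqP lk].
  rewrite (_ : rowsub _ _ = 1%:M) ?det1 //; apply/matrixP => i i'.
  by rewrite !mxE (inj_eq (@ksub_fun_inj _ _ _)).
(* Distinct subsets of equal size: a row [x] chosen by [l] but not by [k] is a zero row of the
   minor. *)
have /subsetPn [x xl xk] : ~~ (val (enum_val l) \subset val (enum_val k)).
  apply: contraNN lk => sub; apply/eqP/enum_val_inj/val_inj/eqP.
  by rewrite eqEcard sub (eqP (valP (enum_val l))) (eqP (valP (enum_val k))) leqnn.
have [i ix] := ksub_fun_onto xl.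
rewrite (expand_det_row _ i) big1 // => i' _; rewrite !mxE ix.
case: eqP => [xe|_]; last by rewrite mul0r.
by rewrite xe ksub_fun_in in xk.
Qed.

Lemma wdim_gt0 n j : (j <= n)%N -> (0 < wdim n j)%N.
Proof.
move=> jn.
have c : #|imset (widen_ord jn) (mem predT)| == j.
  by rewrite card_imset ?card_ord // => i k /(congr1 val) /= /val_inj.
pose s : ksub n j := Sub (imset (widen_ord jn) (mem predT)) c.
by apply/card_gt0P; exists s.
Qed.

(* [f] maximizes [|det (rowsub f X)|]; by Cramer's rule the entries of the product
   are quotients of such determinants by the maximal one. *)
Lemma maximal_rowsub_bound (R : realType) n j (X : 'M[R]_(n, j)) :
  wedge X != 0 -> exists f : {ffun 'I_j -> 'I_n},
    rowsub f X \in unitmx /\ forall i k, `|(X *m invmx (rowsub f X)) i k| <= 1.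
Proof.
move=> X0.
have [k Xk] : exists k, wedge X k ord0 != 0.
  by move/cV0Pn: X0 => [k Xk]; exists k.
pose f0 : {ffun 'I_j -> 'I_n} := [ffun i => ksub_fun (enum_val k) i].
pose F (f : {ffun 'I_j -> 'I_n}) := `|\det (rowsub f X)|.
have F0 : 0 < F f0.
  rewrite normr_gt0; move: Xk; rewrite mxE; congr (\det _ != 0).
  by apply/matrixP => i l; rewrite !mxE ffunE.
case: (@arg_maxP _ _ _ f0 predT F isT) => f _ fmax; exists f.
have Ff : 0 < F f by apply: lt_le_trans F0 (fmax f0 isT).
have fu : rowsub f X \in unitmx by rewrite unitmxE unitfE -normr_gt0.
split => // i l; rewrite /invmx fu -scalemxAr mxE normrM normfV.
rewrite mulrC ler_pdivrMr // mul1r.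
(* [g] selects row [i] in place of the [l]-th chosen row. The cofactors along row [l] do not change,
   so the expansion along it is the adjugate product. *)
pose g : {ffun 'I_j -> 'I_n} := [ffun q => if q == l then i else f q].
suff -> : (X *m \adj (rowsub f X)) i l = \det (rowsub g X) by apply: fmax.
rewrite (expand_det_row _ l) mxE; apply: eq_bigr => q _.
rewrite !mxE ffunE eqxx; congr (_ * _).
rewrite /cofactor; congr (_ * \det _); apply/matrixP => a b.
by rewrite !mxE ffunE eq_sym (negbTE (neq_lift _ _)).
Qed.

(** In the rank factorization of a nonzero column the right factor is a nonzero scalar [a], and [c]
    is [a] times the first column of the invertible left factor. *)
Lemma complete_unitmx (F : fieldType) j (c : 'cV[F]_j.+1) :
  c != 0 -> exists2 G : 'M[F]_j.+1, G \in unitmx & col 0 G = c.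
Proof.
move=> c0.
have rc : \rank c = 1%N.
  by apply/eqP; rewrite eqn_leq rank_leq_col lt0n mxrank_eq0.
have := mulmx_ebase c; rewrite rc (mx11_scalar (row_ebase c)).
have := row_ebase_unit c; rewrite unitmxE det_mx11 unitfE.
set a := row_ebase c 0 0 => a0 ce.
exists (a *: col_ebase c).
  by rewrite unitmxE detZ unitfE mulf_neq0 ?expf_neq0 // -unitfE -unitmxE col_ebase_unit.
rewrite -[RHS]ce mul_mx_scalar linearZ /=; congr (_ *: _).
apply/colP => i; rewrite !mxE (bigD1 0) //= !mxE /= mulr1 big1 ?addr0 // => k k0.
rewrite mxE; case: eqP => [/= k00|_]; last by rewrite mulr0.
by case/eqP: k0; apply: val_inj.
Qed.

(** * Topology of matrices and proper cones *)

Lemma continuous_mx (T : topologicalType) (R : realType) m n (f : T -> 'M[R]_(m, n)) :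
  (forall i j, continuous (fun x => f x i j)) -> continuous f.
Proof.
move=> fc x B [P /= PM sPB].
have : \forall y \near x, forall ij : 'I_m * 'I_n, P ij.1 ij.2 (f y ij.1 ij.2).
  by apply: filter_forall => -[i j]; apply: fc; apply: PM.
by apply: filterS => y Py; apply: sPB => i j; apply: (Py (i, j)).
Qed.

Lemma continuous_coord (T : topologicalType) (R : realType) m n
    (f : T -> 'M[R]_(m, n)) i j :
  continuous f -> continuous (fun x => f x i j).
Proof.
move=> fc x; apply: (@continuous_comp _ _ _ f (fun M : 'M[R]_(m, n) => M i j)).
  exact: fc.
exact: coord_continuous.
Qed.

Lemma continuous_sum (T : topologicalType) (R : realType) (I : finType) (f : I -> T -> R) :
  (forall i, continuous (f i)) -> continuous (fun x => \sum_i f i x).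
Proof. by move=> fc x; apply: cvg_big => [|i _]; [exact: add_continuous|exact: fc]. Qed.

Lemma continuous_prod (T : topologicalType) (R : realType) (I : finType) (f : I -> T -> R) :
  (forall i, continuous (f i)) -> continuous (fun x => \prod_i f i x).
Proof. by move=> fc x; apply: cvg_big => [|i _]; [exact: mul_continuous|exact: fc]. Qed.

Lemma continuous_mulmx (T : topologicalType) (R : realType) m n p
    (f : T -> 'M[R]_(m, n)) (g : T -> 'M[R]_(n, p)) :
  continuous f -> continuous g -> continuous (fun x => f x *m g x).
Proof.
move=> fc gc; apply: continuous_mx => i j.
under eq_fun do rewrite mxE.
apply: continuous_sum => k x; apply: cvgM.
  exact: continuous_coord fc x.
exact: continuous_coord gc x.
Qed.

Lemma continuous_mxsub (T : topologicalType) (R : realType) m n p q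
    (h : 'I_p -> 'I_m) (h' : 'I_q -> 'I_n) (f : T -> 'M[R]_(m, n)) :
  continuous f -> continuous (fun x => mxsub h h' (f x)).
Proof.
move=> fc; apply: continuous_mx => i j.
under eq_fun do rewrite mxE.
exact: continuous_coord.
Qed.

Lemma continuous_subv (T : topologicalType) (R : realType) (V : normedModType R)
    (f g : T -> V) :
  continuous f -> continuous g -> continuous (fun x => f x - g x).
Proof. by move=> fc gc x; apply: (@continuousB _ _ _ f g); [exact: fc|exact: gc]. Qed.

Lemma continuous_scalev (T : topologicalType) (R : realType) (V : normedModType R)
    (f : T -> R) (g : T -> V) :
  continuous f -> continuous g -> continuous (fun x => f x *: g x).
Proof. by move=> fc gc x; apply: (@continuousZ _ _ _ f g); [exact: fc|exact: gc]. Qed.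

Lemma wedge_continuous (R : realType) n j : continuous (@wedge R n j).
Proof.
apply: continuous_mx => k l; under eq_fun do rewrite mxE /determinant.
apply: continuous_sum => s X.
apply: (@continuousM _ _ (fun=> (-1) ^+ s)); first exact: cst_continuous.
apply: continuous_prod => i; under eq_fun do rewrite mxE.
exact: coord_continuous.
Qed.

Lemma compact_mx_box (R : realType) m n (a : R) :
  compact [set M : 'M[R]_(m, n) | forall i j, `|M i j| <= a].
Proof.
have cb : compact [set v : 'rV[R]_(m * n) | forall i, `[- a, a]%classic (v ord0 i)].
  by apply: (@rV_compact R _ (fun=> `[- a, a]%classic)) => _; apply: segment_compact.
have vc : continuous (@vec_mx R m n).
  apply: continuous_mx => i j; under eq_fun do rewrite mxE.
  exact: coord_continuous.
have := continuous_compact (continuous_subspaceT vc) cb.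
congr compact; apply/seteqP; split => [M /= [v vb <-] i j|M Mb /=].
  by rewrite mxE; have := vb (mxvec_index i j); rewrite /= in_itv /= -ler_norml.
exists (mxvec M); last exact: mxvecK.
move=> k /=; case/mxvec_indexP: k => i j.
by rewrite mxvecE in_itv /= -ler_norml.
Qed.

Lemma norm_mx_coord (R : realType) m n (M : 'M[R]_(m, n)) i j : `|M i j| <= `|M|.
Proof. by rewrite [leRHS]/Num.norm /= mx_normrE; apply: (le_bigmax _ _ (i, j)). Qed.

Section Cone.
Variables (R : realType) (m : nat) (K : set 'cV[R]_m).
Hypothesis Kp : proper_cone K.

Lemma coneD x y : K x -> K y -> K (x + y).
Proof. by case: Kp => -[_ _ + _] _ _; apply. Qed.

Lemma coneZ (a : R) x : 0 <= a -> K x -> K (a *: x).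
Proof. by case: Kp => -[_ _ _ +] _ _; apply. Qed.

Lemma cone0 : K 0.
Proof. by case: Kp => -[]. Qed.

Lemma cone_closed : closed K.
Proof. by case: Kp => -[]. Qed.

Lemma cone_pointed x : K x -> K (- x) -> x = 0.
Proof.
move=> Kx KNx; case: Kp => _ + _ => /seteqP [+ _].
by apply; split => //; exists (- x); rewrite ?opprK.
Qed.

Lemma cone_sum (I : finType) (f : I -> 'cV[R]_m) :
  (forall i, K (f i)) -> K (\sum_i f i).
Proof. by move=> Kf; elim/big_ind: _ => //; [exact: cone0|exact: coneD]. Qed.

Lemma int_coneD x y : interior K x -> K y -> interior K (x + y).
Proof.
move=> Kx Ky.
have c : {for x + y, continuous (fun z : 'cV[R]_m => z - y)}.
  apply: (@continuousB _ _ _ id (fun=> y)); first exact: cvg_id.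
  exact: cst_continuous.
have : nbhs (x + y) [set z | K (z - y)] by apply: c; rewrite addrK.
apply: filterS => z Kz.
by have := coneD Kz Ky; rewrite subrK.
Qed.

Lemma int_coneZ (a : R) x : 0 < a -> interior K x -> interior K (a *: x).
Proof.
move=> a0 Kx.
have c : {for a *: x, continuous (fun z : 'cV[R]_m => a^-1 *: z)}.
  exact: scaler_continuous.
have : nbhs (a *: x) [set z | K (a^-1 *: z)].
  by apply: c; rewrite scalerA mulVf ?gt_eqF // scale1r.
apply: filterS => z Kz.
by have := coneZ (ltW a0) Kz; rewrite scalerA divff ?gt_eqF // scale1r.
Qed.

Lemma int_cone_absorbing x : interior K x ->
  exists2 C : R, 0 < C & forall z, K ((C * `|z|) *: x + z).
Proof.
(* The factor [2 / e] rescales [z] to norm [e / 2], within the ball around [x] contained in [K]. *)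
move=> /nbhs_ballP [e /= e0 xK]; exists (2 / e); first by rewrite divr_gt0.
move=> z; have [->|z0] := eqVneq z 0.
  by rewrite normr0 mulr0 scale0r addr0; apply: cone0.
have z1 : 0 < `|z| by rewrite normr_gt0.
have c0 : 0 < 2 / e * `|z| by rewrite mulr_gt0 // divr_gt0.
have -> : (2 / e * `|z|) *: x + z =
    (2 / e * `|z|) *: (x + (2 / e * `|z|)^-1 *: z).
  by rewrite scalerDr scalerA divff ?gt_eqF // scale1r.
apply: (coneZ (ltW c0)); apply: xK; rewrite mx_norm_ball /ball_ /= opprD addrA subrr sub0r.
rewrite normrN normrZ gtr0_norm ?invr_gt0 // invfM mulfVK ?gt_eqF // invf_div.
by rewrite ltr_pdivrMr // mulr_natr mulr2n ltrDl.
Qed.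

(** An interior zero would make [K] absorb every vector, against pointedness in positive
    dimension. *)
Lemma int_cone_neq0 x : (0 < m)%N -> interior K x -> x != 0.
Proof.
move=> m0 Kx; apply/eqP => x0; move: Kx; rewrite x0.
move=> /int_cone_absorbing [C C0 H].
pose e : 'cV[R]_m := const_mx 1.
have := H e; have := H (- e); rewrite !scaler0 !add0r => KN K1.
have := cone_pointed K1 KN => /matrixP /(_ (Ordinal m0) 0).
by rewrite !mxE => /eqP; rewrite oner_eq0.
Qed.
End Cone.

Lemma interior_neg_set (R : realType) m (K : set 'cV[R]_m) x :
  interior (neg_set K) x <-> interior K (- x).
Proof.
have c := @opp_continuous 'cV[R]_m; split => h.
  have : nbhs (- x) [set z | neg_set K (- z)] by apply: c; rewrite opprK.
  by apply: filterS => z [y Ky] /oppr_inj <-.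
have : nbhs x [set z | K (- z)] by apply: c.
by apply: filterS => z Kz; exists (- z); rewrite ?opprK.
Qed.

(** * Positive operators *)

Section KPositive.
Variables (R : realType) (m : nat) (K : set 'cV[R]_m) (B : 'M[R]_m).
Hypotheses (Kp : proper_cone K) (Bp : K_positive B K).

(** On the compact set of unit vectors of [K], both [B *m w] and [p] are interior, so a small
    multiple of the other can be subtracted, uniformly in [w]; homogeneity does the rest. *)
Lemma K_positive_bounds p : interior K p ->
  exists c : R, [/\ 0 < c, c <= 1 & forall w, K w ->
    K (B *m w - (c * `|w|) *: p) /\ K (`|w| *: p - c *: (B *m w))].
Proof.
move=> Kpp.
pose S := [set w | K w /\ `|w| = 1].
have cS : compact S.
  apply: subclosed_compact (@compact_mx_box R m 1 1) _; last first.
    by move=> w [_ w1] i j; rewrite -w1 norm_mx_coord.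
  apply: closedI; first exact: cone_closed.
  apply: (@preimage_closed _ _ (fun w : 'cV[R]_m => `|w|) [set 1]).
    by move=> w _; apply: norm_continuous.
  exact/accessible_closed_set1/hausdorff_accessible/Rhausdorff.
have ct1 : continuous (fun z : 'cV[R]_m * R => B *m z.1 - z.2 *: p).
  apply: continuous_subv; last first.
    by apply: continuous_scalev => z; [exact: cvg_snd|exact: cst_continuous].
  by apply: continuous_mulmx => z; [exact: cst_continuous|exact: cvg_fst].
have ct2 : continuous (fun z : 'cV[R]_m * R => p - z.2 *: (B *m z.1)).
  apply: continuous_subv => [z|]; first exact: cst_continuous.
  apply: continuous_scalev => [z|]; first exact: cvg_snd.
  by apply: continuous_mulmx => z; [exact: cst_continuous|exact: cvg_fst].
have /compact_near_coveringP cov := cS.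
have : \forall e \near (0 : R), S `<=`
    [set w | K (B *m w - e *: p) /\ K (p - e *: (B *m w))].
  apply: (cov R (nbhs (0 : R)) (fun e w => K (B *m w - e *: p) /\
    K (p - e *: (B *m w))) (nbhs_filter _)) => w [Kw w1].
  have w0 : w != 0 by rewrite -normr_eq0 w1 oner_eq0.
  have n1 : nbhs (w, 0 : R) [set z | K (B *m z.1 - z.2 *: p)].
    by apply: (ct1 (w, 0)); rewrite /= scale0r subr0; apply: Bp.
  have n2 : nbhs (w, 0 : R) [set z | K (p - z.2 *: (B *m z.1))].
    by apply: (ct2 (w, 0)); rewrite /= scale0r subr0.
  exact: filterI n1 n2.
move=> /nbhs_ballP [r /= r0 rS].
pose c := Num.min (r / 2) 1.
have c0 : 0 < c by rewrite lt_min divr_gt0 //=.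
have c1 : c <= 1 by rewrite ge_min lexx orbT.
exists c; split => // w Kw.
have [->|w0] := eqVneq w 0.
  by rewrite mulmx0 normr0 mulr0 !scale0r scaler0 subr0; split; apply: cone0 Kp.
have w1 : 0 < `|w| by rewrite normr_gt0.
have Sw : S (`|w|^-1 *: w).
  split; first by apply: coneZ; rewrite ?invr_ge0 ?normr_ge0.
  by rewrite normrZ normfV normr_id mulVf ?gt_eqF.
have /rS /(_ _ Sw) [/= K1 K2] : ball (0 : R) r c.
  rewrite /ball /= sub0r normrN gtr0_norm // gt_min.
  by rewrite ltr_pdivrMr // mulr_natr mulr2n ltrDl r0.
split.
  have := coneZ Kp (ltW w1) K1; rewrite -scalemxAr scalerBr !scalerA divff ?gt_eqF //.
  by rewrite scale1r mulrC.
have := coneZ Kp (ltW w1) K2; rewrite -scalemxAr scalerBr !scalerA.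
by rewrite mulrAC divff ?gt_eqF // mul1r.
Qed.

(* If [B (t u - v)] were too small compared with [B (t u + v)], their difference
   [2 B v] would be interior; so both dominate a multiple of [t B u]. *)
Lemma order_interval_contraction (c t : R) p u v : interior K p ->
  0 < c -> c <= 1 ->
  (forall w, K w ->
    K (B *m w - (c * `|w|) *: p) /\ K (`|w| *: p - c *: (B *m w))) ->
  0 <= t -> K u -> K (t *: u - v) -> K (t *: u + v) -> ~ interior K (B *m v) ->
  K (((1 - c ^+ 4) * t) *: (B *m u) - B *m v).
Proof.
move=> Kpp c0 c1 H t0 Ku Kw1 Kw2 nK.
have [K1 K1'] := H _ Kw1; have [K2 K2'] := H _ Kw2; have [_ Ku'] := H _ Ku.
have tri : 2 * t * `|u| <= `|t *: u - v| + `|t *: u + v|.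
  rewrite -{1}(ger0_norm t0) -mulrA -normrZ -(@ger0_norm _ (2 : R)) // -normrZ.
  apply: le_trans (ler_normD _ _); rewrite le_eqVlt; apply/orP; left; apply/eqP.
  by congr `|_|; apply/colP => i; rewrite !mxE; ring.
move: K1 K1' K2 K2'; rewrite mulmxBr mulmxDr -scalemxAr.
move: tri nK Ku' (normr_ge0 u).
set n1 := `|t *: u - v|; set n2 := `|t *: u + v|; set nu := `|u|.
move: (B *m u) (B *m v) => Bu Bv tri nK Ku' nu0 K1 K1' K2 K2'.
have n12 : c ^+ 2 * n2 <= n1.
  rewrite leNgt; apply/negP => lt; apply: nK.
  have -> : Bv = (2 * c)^-1 *: ((c ^+ 2 * n2 - n1) *: p +
     ((n1 *: p - c *: (t *: Bu - Bv)) + c *: (t *: Bu + Bv - (c * n2) *: p))).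
    by apply/colP => i; rewrite !mxE; field; rewrite gt_eqF.
  apply: int_coneZ => //; first by rewrite invr_gt0 mulr_gt0.
  apply: int_coneD => //; first by apply: int_coneZ => //; rewrite subr_gt0.
  by apply: coneD => //; apply: coneZ => //; apply: ltW.
(* Multiply [tri] by [c ^+ 2] and use [n12]: the right side is at most [2 * n1]. *)
have n1u : c ^+ 2 * t * nu <= n1.
  have c2 : c ^+ 2 <= 1 by rewrite expr_le1 // ltW.
  have c20 : 0 <= c ^+ 2 by rewrite exprn_ge0 // ltW.
  have n10 : 0 <= n1 by apply: normr_ge0.
  nra.
(* In the cone order, [t *: Bu - Bv] dominates [(c * n1) *: p], hence [(c ^+ 3 * t * nu) *: p],
   hence [(c ^+ 4 * t) *: Bu]; this is where the fourth power comes from. *)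
have -> : ((1 - c ^+ 4) * t) *: Bu - Bv =
  (t *: Bu - Bv - (c * n1) *: p) + ((c * (n1 - c ^+ 2 * t * nu)) *: p +
     (c ^+ 3 * t) *: (nu *: p - c *: Bu)).
  by apply/colP => i; rewrite !mxE; ring.
have Kip : K p by apply: interior_subset.
apply: coneD => //; apply: coneD => //; apply: coneZ => //.
  by rewrite mulr_ge0 ?subr_ge0 // ltW.
by rewrite mulr_ge0 // exprn_ge0 // ltW.
Qed.

(** [D] will be the decomposable vectors up to sign, which need not be closed under addition; hence
    only basis vectors and invariance are assumed. *)
Lemma K_positive_orbit_meets (D : set 'cV[R]_m) : (0 < m)%N ->
  (forall k, D (delta_mx k 0)) -> (forall w, D w -> D (B *m w)) ->
  exists w, D w /\ (interior K w \/ interior K (- w)).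
Proof.
move=> m0 Db DB; apply: contrapT => /forallNP noD.
have {}noD w : D w -> ~ interior K w /\ ~ interior K (- w).
  by move=> Dw; split => Kw; apply: (noD w); split; tauto.
have [p Kpp] : interior K !=set0 by case: Kp.
have [c [c0 c1 cP]] := K_positive_bounds Kpp.
pose q := 1 - c ^+ 4.
have q0 : 0 <= q by rewrite subr_ge0 exprn_ile1 // ltW.
have q1 : q < 1 by rewrite ltrBlDr ltrDl exprn_gt0.
pose u N := iter N (mulmx B) p; pose e k N := iter N (mulmx B) (delta_mx k 0 : 'cV[R]_m).
have Ku N : interior K (u N).
  elim: N => [//|N IH]; apply: Bp; last exact: int_cone_neq0 IH.
  exact: interior_subset.
have De k N : D (e k N) by elim: N => [|N IH]; [exact: Db|exact: DB].
have [C C0 CP] := int_cone_absorbing Kp Kpp.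
pose t k := C * `|delta_mx k 0 : 'cV[R]_m|.
have t0 k : 0 <= t k by rewrite mulr_ge0 // ltW.
(* Absorption at [p] gives the start; each application of [B] gains a factor [q], the contraction
   being applied to [e k N] and to its opposite. *)
have eP k N : K ((q ^+ N * t k) *: u N - e k N) /\ K ((q ^+ N * t k) *: u N + e k N).
  elim: N => [|N [IH1 IH2]].
    by rewrite expr0 mul1r /t; split; [rewrite -normrN|]; apply: CP.
  have tN : 0 <= q ^+ N * t k by rewrite mulr_ge0 ?exprn_ge0.
  have [n1 n2] := noD _ (De k N.+1).
  have KuN : K (u N) by apply: interior_subset.
  rewrite exprS -mulrA; split.
    exact: (order_interval_contraction Kpp c0 c1 cP tN).
  rewrite -[e k N.+1]opprK -mulmxN.
  by apply: (order_interval_contraction Kpp c0 c1 cP tN); rewrite ?opprK // mulmxN.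
have uE N : u N = \sum_k p k 0 *: e k N.
  elim: N => [|N IH].
    rewrite [LHS](matrix_sum_delta p); apply: eq_bigr => k _.
    by rewrite big_ord1.
  rewrite [LHS]/= -/(u N) IH mulmx_sumr; apply: eq_bigr => k _.
  by rewrite -scalemxAr.
pose M := \sum_k `|p k 0| * t k.
(* Sum the bounds on the [e k N], weighted by the fixed coefficients [p k 0]; the sign of each
   coefficient decides which of the two bounds applies. *)
have KM N : K ((q ^+ N * M) *: u N - u N).
  rewrite {2}uE mulr_sumr scaler_suml -sumrB; apply: cone_sum => // k.
  have [e1 e2] := eP k N.
  have -> : (q ^+ N * (`|p k 0| * t k)) *: u N - p k 0 *: e k N =
    `|p k 0| *: ((q ^+ N * t k) *: u N - Num.sg (p k 0) *: e k N).
    rewrite scalerBr !scalerA [_ * Num.sg _]mulrC -numEsg.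
    by congr (_ *: _ - _); ring.
  apply: coneZ => //; case: (sgrP (p k 0)) => _; rewrite ?scale0r ?scale1r ?scaleN1r ?opprK //.
  rewrite subr0; apply: coneZ => //; first by rewrite mulr_ge0 ?exprn_ge0.
  exact: interior_subset.
have [N qN] : exists N, q ^+ N * M < 1.
  have M0 : 0 <= M by apply: sumr_ge0 => k _; rewrite mulr_ge0.
  have M1 : 0 < (M + 1)^-1 by rewrite invr_gt0 ltr_wpDl.
  have : `|q| < 1 by rewrite ger0_norm.
  move/cvg_expr/cvgrPdist_lt/(_ _ M1) => [N _ /(_ N (leqnn N))] /=.
  rewrite sub0r normrN ger0_norm ?exprn_ge0 // => h; exists N.
  have := exprn_ge0 N q0; move: h.
  by rewrite -div1r ltr_pdivlMr ?ltr_wpDl // mulrDr mulr1; lra.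
(* Once [q ^+ N * M < 1], the vector in [KM] is a negative multiple of [u N], which contradicts
   pointedness. *)
have : K (- u N).
  have -> : - u N = (1 - q ^+ N * M)^-1 *: ((q ^+ N * M) *: u N - u N).
    move: (u N) => y; apply/colP => i; rewrite !mxE; field.
    by rewrite gt_eqF // subr_gt0.
  by apply: coneZ => //; rewrite invr_ge0 subr_ge0 ltW.
move/(cone_pointed Kp (interior_subset (Ku N))) => /eqP.
by rewrite (negbTE (int_cone_neq0 Kp m0 (Ku N))).
Qed.
End KPositive.

(** * The sets [T(K_j)] *)

(** The set whose closure is [TK] from index two on; including index one lets a single argument
    treat all cases. *)
Definition wedge_heads (R : realType) n j (K : set 'cV[R]_(wdim n j.+1)) :=
  [set x | exists X : 'M[R]_(n, j.+1),
    col 0 X = x /\ (interior K `|` interior (neg_set K)) (wedge X)].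

Lemma wedge_heads_open (R : realType) n j (K : set 'cV[R]_(wdim n j.+1)) x :
  wedge_heads K x -> interior (wedge_heads K) x.
Proof.
move=> [X [Xx UX]].
(* Only the first column varies; the wedge then depends continuously on it and stays in the open
   set. *)
pose g (y : 'cV[R]_n) : 'M[R]_(n, j.+1) :=
  \matrix_(i, k) if k == 0 then y i 0 else X i k.
have gc : continuous (fun y => wedge (g y)).
  move=> y; apply: (@continuous_comp _ _ _ g (@wedge R n j.+1)).
    apply: continuous_mx => i k; under eq_fun do rewrite mxE.
    by case: eqP => _; [exact: coord_continuous|exact: cst_continuous].
  exact: wedge_continuous.
have gx : g x = X by apply/matrixP => i k; rewrite !mxE; case: eqP => // ->; rewrite -Xx mxE.
have gcol y : col 0 (g y) = y by apply/colP => i; rewrite !mxE eqxx.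
have UoX : nbhs (wedge X) (interior K `|` interior (neg_set K)).
  by apply: open_nbhs_nbhs; split => //; apply: openU; apply: open_interior.
have : nbhs x [set y | (interior K `|` interior (neg_set K)) (wedge (g y))].
  by apply: gc; rewrite gx.
by apply: filterS => y Uy; exists (g y).
Qed.

Lemma cone_or_neg_scale (R : realType) m (K : set 'cV[R]_m) (a : R) w :
  proper_cone K -> K w \/ K (- w) -> K (a *: w) \/ K (- (a *: w)).
Proof.
move=> Kp Kw; have [a0|/ltW a0] := leP 0 a.
  by case: Kw => /(coneZ Kp a0); rewrite ?scalerN; tauto.
rewrite -oppr_ge0 in a0.
by case: Kw => /(coneZ Kp a0); rewrite ?scalerN scaleNr ?opprK; tauto.
Qed.

Lemma closure_wedge_heads (R : realType) n j (K : set 'cV[R]_(wdim n j.+1)) x :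
  proper_cone K -> (j.+1 <= n)%N -> closure (wedge_heads K) x -> x != 0 ->
  exists Z : 'M[R]_(n, j.+1),
    [/\ col 0 Z = x, wedge Z != 0 & K (wedge Z) \/ K (- wedge Z)].
Proof.
move=> Kp jn clx x0.
(* Because the rows [f] of [Y] form the identity, the coefficients of [y] in the columns of [Y] are
   its own entries at [f]. So [P f] is a closed condition on the pair, and the wedge cannot
   degenerate in the limit. *)
pose P (f : {ffun 'I_j.+1 -> 'I_n}) (y : 'cV[R]_n) (Y : 'M[R]_(n, j.+1)) :=
  [/\ rowsub f Y = 1%:M, y = Y *m rowsub f y & K (wedge Y) \/ K (- wedge Y)].
pose Q := [set Y : 'M[R]_(n, j.+1) | forall i k, `|Y i k| <= 1].
have headsP y : wedge_heads K y -> exists f Y, Q Y /\ P f y Y.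
  move=> [X [Xy UX]].
  have KX : K (wedge X) \/ K (- wedge X).
    case: UX => [/interior_subset|/interior_neg_set/interior_subset]; tauto.
  have X0 : wedge X != 0.
    case: UX => [|/interior_neg_set] /(int_cone_neq0 Kp (wdim_gt0 jn)) //.
    by rewrite oppr_eq0.
  have [f [fu fb]] := maximal_rowsub_bound X0.
  exists f, (X *m invmx (rowsub f X)); split => //; split.
  - by rewrite -mul_rowsub_mx mulmxV.
  - rewrite -Xy -mulmxA; have -> : rowsub f (col 0 X) = col 0 (rowsub f X).
      by apply/colP => i; rewrite !mxE.
    by rewrite !colE mulKmx.
  - by rewrite wedge_mulr; apply: cone_or_neg_scale.
have [f [Y [Yf xY KY]]] : exists f Y, P f x Y.
  apply: contrapT => /forallNP noP.
  have {}noP f Y : ~ P f x Y by move=> h; apply: (noP f); exists Y.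
  have Pclosed f : closed [set z : 'M[R]_(n, j.+1) * 'cV[R]_n | P f z.2 z.1].
    have mx0 p q : closed [set (0 : 'M[R]_(p, q))].
      exact/accessible_closed_set1/hausdorff_accessible/norm_hausdorff.
    have -> : [set z : 'M[R]_(n, j.+1) * 'cV[R]_n | P f z.2 z.1] =
      (fun z => rowsub f z.1 - 1%:M) @^-1` [set 0] `&`
      ((fun z => z.2 - z.1 *m rowsub f z.2) @^-1` [set 0] `&`
       ((fun z => wedge z.1) @^-1` K `|` (fun z => 0 - wedge z.1) @^-1` K)).
      apply/seteqP; split => -[Y y] /=; rewrite /P !sub0r.
        by move=> [-> <- ?]; rewrite !subrr.
      by move=> [/subr0_eq -> [/subr0_eq <- ?]].
    have c1 : continuous (fun z : 'M[R]_(n, j.+1) * 'cV[R]_n => z.1).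
      by move=> z; apply: cvg_fst.
    have c2 : continuous (fun z : 'M[R]_(n, j.+1) * 'cV[R]_n => z.2).
      by move=> z; apply: cvg_snd.
    have c3 : continuous (fun z : 'M[R]_(n, j.+1) * 'cV[R]_n => wedge z.1).
      move=> z; apply: (@continuous_comp _ _ _ fst (@wedge R n j.+1)).
        exact: c1.
      exact: wedge_continuous.
    apply: closedI; last apply: closedI; last apply: closedU.
    - apply: preimage_closed (mx0 _ _) => z _; apply: continuous_subv.
        exact: continuous_mxsub.
      exact: cst_continuous.
    - apply: preimage_closed (mx0 _ _) => z _; apply: continuous_subv => //.
      by apply: continuous_mulmx => //; apply: continuous_mxsub.
    - by apply: preimage_closed (cone_closed Kp) => z _; apply: c3.
    - apply: preimage_closed (cone_closed Kp) => z _.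
      by apply: continuous_subv => //; apply: cst_continuous.
  have /compact_near_coveringP cov := @compact_mx_box R n j.+1 1.
  (* If no pair works at [x], compactness of [Q] excludes all pairs for every [y] near [x], although
     some of these [y] lie in [wedge_heads K]. *)
  have near_noP : \forall y \near x, Q `<=` [set Y | forall f, ~ P f y Y].
    apply: (cov _ (nbhs x) (fun y Y => forall f, ~ P f y Y) (nbhs_filter _)) => Y _.
    have : nbhs (Y, x) [set z : 'M[R]_(n, j.+1) * 'cV[R]_n | forall f, ~ P f z.2 z.1].
      apply: (@filter_forall _ _ (fun f (z : 'M[R]_(n, j.+1) * 'cV[R]_n) =>
        ~ P f z.2 z.1) _ (nbhs_filter (Y, x))) => f.
      apply: open_nbhs_nbhs; split; last exact: noP.
      exact: closed_openC (Pclosed f).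
    by [].
  have [y [/headsP [f [Y [QY PY]]] ny]] := clx _ near_noP.
  exact: (ny _ QY f).
(* An invertible [G] whose first column holds the coefficients of [x] makes [x] the first column of
   [Y *m G], and only rescales the wedge by the determinant of [G]. *)
have c0 : rowsub f x != 0.
  by apply: contraNneq x0 => c0; rewrite xY c0 mulmx0.
have [G Gu Gc] := complete_unitmx c0.
exists (Y *m G); split.
- by rewrite colE -mulmxA -colE Gc -xY.
- rewrite wedge_mulr scaler_eq0 negb_or -unitfE -unitmxE Gu /=.
  apply/eqP => /(wedge_eq0 f); rewrite Yf det1 => /eqP.
  by rewrite oner_eq0.
- by rewrite wedge_mulr; apply: cone_or_neg_scale.
Qed.

(** The signs of [eps] and of the wedge only exchange the two halves of the union. *)
Lemma positive_wedge_image (R : realType) n j (A : 'M[R]_n) (eps : R)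
    (K : set 'cV[R]_(wdim n j)) (Z : 'M[R]_(n, j)) :
  eps = 1 \/ eps = -1 -> K_positive (eps *: compound j A) K ->
  wedge Z != 0 -> K (wedge Z) \/ K (- wedge Z) ->
  (interior K `|` interior (neg_set K)) (wedge (A *m Z)).
Proof.
move=> e1 Bp Z0 KZ; rewrite wedge_mull.
have : interior K (eps *: (compound j A *m wedge Z)) \/
       interior K (- (eps *: (compound j A *m wedge Z))).
  case: KZ => /Bp; rewrite ?oppr_eq0 => /(_ Z0).
    by rewrite -scalemxAl; left.
  by rewrite mulmxN -scalemxAl; right.
by case: e1 => ->; rewrite ?scale1r ?scaleN1r ?opprK => -[]; [left|right|right|left];
  rewrite ?interior_neg_set //; apply/interior_neg_set.
Qed.

Lemma wedge_heads_nonempty (R : realType) n j (A : 'M[R]_n) (eps : R)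
    (K : set 'cV[R]_(wdim n j.+1)) :
  (j.+1 <= n)%N -> proper_cone K -> eps = 1 \/ eps = -1 ->
  K_positive (eps *: compound j.+1 A) K -> wedge_heads K !=set0.
Proof.
move=> jn Kp e1 Bp.
(* Both signs are allowed so that [D] is invariant under [eps *: compound j.+1 A] even when [eps] is
   negative. *)
pose D := [set w | exists X : 'M[R]_(n, j.+1), w = wedge X \/ w = - wedge X].
have [||w [[X wX] Kw]] := @K_positive_orbit_meets _ _ _ _ Kp Bp D (wdim_gt0 jn).
- by move=> k; exists (colsub (ksub_fun (enum_val k)) 1%:M); left; rewrite wedge_basis.
- move=> w [X wX]; exists (A *m X); rewrite wedge_mull.
  case: wX e1 => -> [] ->; rewrite ?mulmxN -scalemxAl ?scale1r ?scaleN1r ?opprK; tauto.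
exists (col 0 X), X; split => //.
case: wX Kw => -> []; rewrite ?opprK => h; by [left|right; apply/interior_neg_set].
Qed.

Lemma wedge_col1_neq0 (R : realType) n (x : 'cV[R]_n) : x != 0 -> wedge x != 0.
Proof.
apply: contraNneq => w0; apply/eqP/colP => i; rewrite mxE.
by have := wedge_eq0 (fun=> i) w0; rewrite det_mx11 mxE.
Qed.

Theorem theorem25 (R : realType) (n : nat) (A : 'M[R]_n)
  (K : forall j : nat, set 'cV[R]_(wdim n j)) :
  TP_structure K -> GSSR A K ->
  forall j : nat, (1 <= j <= n)%N ->
    interior (TK (K j)) !=set0 /\
    (forall x : 'cV[R]_n, TK (K j) x -> x != 0 -> interior (TK (K j)) (A *m x)).
Proof.
move=> TP [eps GA] [//|j] jn.
have Kp := TP _ jn; have [e1 Bp] := GA _ jn; have /= jn' := jn.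
(* Index one is separate, since there [TK] is the double cone itself and a one-column matrix is its
   own first column. *)
have sub : wedge_heads (K j.+1) `<=` TK (K j.+1).
  case: j {jn jn' Kp e1 Bp} => [x [X [<- UX]]|j]; last exact: subset_closure.
  have -> : col 0 X = X by apply/matrixP => i k; rewrite mxE ord1.
  by case: UX => [/interior_subset|/interior_subset]; [left|right].
have lift x : TK (K j.+1) x -> x != 0 -> exists Z : 'M[R]_(n, j.+1),
    [/\ col 0 Z = x, wedge Z != 0 & K j.+1 (wedge Z) \/ K j.+1 (- wedge Z)].
  move: (K j.+1) Kp => K1; case: j {jn sub GA Bp e1} jn' K1 => [_|j jn'] K1 Kp Tx x0.
    exists x; split; last 1 first.
    - by case: Tx => [|[y Ky <-]]; [left|right; rewrite opprK].
    - by apply/matrixP => i k; rewrite mxE ord1.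
    - exact: wedge_col1_neq0.
  exact: closure_wedge_heads.
split.
  have [x /wedge_heads_open hx] := wedge_heads_nonempty jn' Kp e1 Bp.
  by exists x; apply: interiorS sub _ hx.
(* [A *m Z] has first column [A *m x] and its wedge is interior up to sign, so [A *m x] lies in the
   open set [wedge_heads]. *)
move=> x /lift h /h [Z [Zx Z0 KZ]].
apply: (interiorS sub); apply: wedge_heads_open; exists (A *m Z); split.
  by rewrite -Zx !colE mulmxA.
exact: positive_wedge_image e1 Bp Z0 KZ.
Qed.
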